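(* Let $n$ be a positive even integer. With coefficients in $\mathbb{F}_2$, there is an exact sequence of $\mathbb{F}_2[\mathfrak{S}_n]$-modules $$0\longrightarrow T^{(n)}\xrightarrow{\psi_{n-2}^n} T^{(n-1,1)}\xrightarrow{\psi_{n-4}^n}\cdots\xrightarrow{\psi_2^n}T^{(n/2+1,n/2-1)}\xrightarrow{\psi_0^n}T^{(n/2,n/2)}\longrightarrow 0,$$ where, for $1\le k\le n/2$, $\psi_{n-2k}^n\colon T^{(n-k+1,k-1)}\to T^{(n-k,k)}$ is multiplication by $\sum_{i=1}^n z_i$.
   Context: The symmetric group $\mathfrak{S}_n$ acts on $\mathbb{F}_2[z_1,\dots,z_n]$ by permuting the variables. A Young tableau $t$ of shape $\lambda\vdash n$ is a bijective filling of the Young diagram of $\lambda$ with $1,\dots,n$. The polynomial $F_t$ is the product of $z_i-z_j$ over all pairs of cells in the same column, with the cell labeled $i$ above the cell labeled $j$. The Specht module $S^\lambda$ is the $\mathbb{F}_2[\mathfrak{S}_n]$-submodule of $\mathbb{F}_2[z_1,\dots,z_n]$ spanned by $F_t$ over all Young tableaux $t$ of shape $\lambda$. For a two-row partition $\lambda=(n-k,k)$, $0\le k\le n/2$ (with $(n,0)=(n)$), $T^\lambda$ is the image of $S^\lambda$ under the quotient map $\mathbb{F}_2[z_1,\dots,z_n]\to\mathbb{F}_2[z_1,\dots,z_n]/(z_1^2,\dots,z_n^2)$; multiplication by $\sum_i z_i$ takes place in this quotient ring. *)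

(* Defs.v *)
From HB Require Import structures.
From mathcomp Require Import all_boot all_order all_fingroup all_algebra.
From mathcomp Require Export mpoly.
From mathcomp Require Import generic_quotient ring_quotient boolp.

Set Implicit Arguments.
Unset Strict Implicit.
Unset Printing Implicit Defensive.

Import GRing.Theory.

Local Open Scope ring_scope.
Local Open Scope quotient_scope.

(* The cell [Tagged _ j] with tag [i] lies in row i and column j; rows are
   numbered from top to bottom. *)

Definition cell (lam : seq nat) : finType :=
  {i : 'I_(size lam) & 'I_(nth 0%N lam i)}.

Definition cell_row lam (c : cell lam) : nat := tag c.

Definition cell_col lam (c : cell lam) : nat := tagged c.

Definition is_tableau n lam (t : {ffun cell lam -> 'I_n}) : bool :=
  injectiveb t && [forall i, i \in codom t].

Definition tableau_poly n lam (t : {ffun cell lam -> 'I_n}) :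
    {mpoly 'F_2[n]} :=
  \prod_(cd : cell lam * cell lam |
           (cell_col cd.1 == cell_col cd.2) && (cell_row cd.1 < cell_row cd.2)%N)
     ('X_(t cd.1) - 'X_(t cd.2)).

(* The F_2[S_n]-span of the F_t, with coefficients \sum_s (a t s) s in the
   group algebra.  [msym s] is the algebra automorphism sending 'X_i to 'X_(s i), and the
   product of 'S_n satisfies (s1 * s2) i = s2 (s1 i). *)

Definition specht n (lam : seq nat) : {pred {mpoly 'F_2[n]}} :=
  [pred p | `[< exists a : {ffun cell lam -> 'I_n} -> 'S_n -> 'F_2,
    p = \sum_(t | is_tableau t)
          \sum_(s : 'S_n) a t s *: msym s (tableau_poly t) >]].
Arguments specht : clear implicits.

Definition zsq_ideal n : {pred {mpoly 'F_2[n]}} :=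
  [pred p | `[< exists q : 'I_n -> {mpoly 'F_2[n]},
                  p = \sum_(i < n) q i * 'X_i ^+ 2 >]].
Arguments zsq_ideal : clear implicits.

Lemma zsq_idealr_closed n : idealr_closed (zsq_ideal n).
Proof.
split.
- apply/asboolP; exists (fun=> 0).
  by rewrite big1 // => i _; rewrite mul0r.
- apply/asboolP => -[q /(congr1 (meval (fun=> 0)))].
  rewrite meval1 raddf_sum /= big1 => [/eqP|i _]; first by rewrite oner_eq0.
  by rewrite mevalM rmorphXn /= mevalXU expr0n mulr0.
- move=> a u v /asboolP[q ->] /asboolP[r ->].
  apply/asboolP; exists (fun i => a * q i + r i).
  rewrite mulr_sumr -big_split /=; apply: eq_bigr => i _.
  by rewrite mulrDl mulrA.
Qed.

HB.instance Definition _ n :=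
  isIdealr.Build {mpoly 'F_2[n]} (zsq_ideal n) (@zsq_idealr_closed n).

Definition zquot n := {ideal_quot (zsq_ideal n : idealr _)}.

HB.instance Definition _ n := GRing.ComNzRing.on (zquot n).
HB.instance Definition _ n := NzRingQuotient.on (zquot n).

Definition zproj n (p : {mpoly 'F_2[n]}) : zquot n := \pi_(zquot n) p.

HB.instance Definition _ n := GRing.RMorphism.copy (@zproj n) (\pi_(zquot n)).

Definition zscale n (c : 'F_2) (x : zquot n) : zquot n := zproj c%:MP * x.

Fact zscaleA n a b (x : zquot n) : zscale a (zscale b x) = zscale (a * b) x.
Proof. by rewrite /zscale mulrA -rmorphM mpolyCM. Qed.

Fact zscale1 n : left_id 1 (@zscale n).
Proof. by move=> x; rewrite /zscale mpolyC1 rmorph1 mul1r. Qed.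

Fact zscaleDr n : right_distributive (@zscale n) +%R.
Proof. by move=> a x y; rewrite /zscale mulrDr. Qed.

Fact zscaleDl n (x : zquot n) : {morph (@zscale n)^~ x : a b / a + b}.
Proof. by move=> a b; rewrite /zscale mpolyCD rmorphD mulrDl. Qed.

HB.instance Definition _ n := GRing.Zmodule_isLmodule.Build 'F_2 (zquot n)
  (@zscaleA n) (@zscale1 n) (@zscaleDr n) (@zscaleDl n).

(* The induced action on the quotient, well defined by [zact_proj]. *)

Definition zact n (s : 'S_n) (x : zquot n) : zquot n := zproj (msym s (repr x)).

Lemma msym_zsq_ideal n (s : 'S_n) p :
  p \in zsq_ideal n -> msym s p \in zsq_ideal n.
Proof.
case/asboolP=> q ->; apply/asboolP.
exists (fun i => msym s (q ((s^-1)%g i))).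
rewrite raddf_sum (reindex_inj (@perm_inj _ (s^-1)%g)) /=.
apply: eq_bigr => i _; rewrite msymM rmorphXn /= msymX.
congr (_ * 'X_[_] ^+ 2); apply/mnmP => j.
by rewrite mnmE !mnm1E (inj_eq perm_inj).
Qed.

Lemma zact_proj n (s : 'S_n) p : zact s (zproj p) = zproj (msym s p).
Proof.
rewrite /zact; apply/eqP; rewrite -subr_eq0 -rmorphB -msymB.
rewrite -(rmorph0 (@zproj n)) /zproj.
rewrite -[_ == _](Quotient.idealrBE (zsq_ideal n : idealr _)) subr0.
apply: msym_zsq_ideal.
rewrite (Quotient.idealrBE (zsq_ideal n : idealr _)).
by apply/eqP; rewrite reprK.
Qed.

Lemma zproj_scale n c p : @zproj n (c *: p) = c *: zproj p.
Proof. by rewrite -mul_mpolyC rmorphM. Qed.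

(* T^(n-k,k), as a subset of the quotient ring; [nth] makes [:: n; 0] denote
   the same diagram as (n). *)

Definition two_row n k : seq nat := [:: n - k; k]%N.

Definition T n k : {pred zquot n} :=
  [pred x | `[< exists2 p, p \in specht n (two_row n k) & x = zproj p >]].
Arguments T : clear implicits.

Definition psi n (x : zquot n) : zquot n := (\sum_(i < n) zproj 'X_i) * x.

(* F_2[S_n]-modules are F_2-spaces with an F_2-linear action of S_n. *)

Definition Sn_submodule n (V : {pred zquot n}) : Prop :=
  submod_closed V /\ forall s : 'S_n, {in V, forall x, zact s x \in V}.

Definition Sn_hom n (V W : {pred zquot n}) (f : zquot n -> zquot n) : Prop :=
  [/\ {in V, forall x, f x \in W},
      forall c : 'F_2, {in V &, forall x y, f (c *: x + y) = c *: f x + f y}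
    & forall s : 'S_n, {in V, forall x, f (zact s x) = zact s (f x)}].

(* Exactness at V of U --f--> V --g--> W; the condition does not involve W. *)

Definition exact_at n (U V : {pred zquot n}) (f g : zquot n -> zquot n) : Prop :=
  forall x, x \in V -> (g x = 0 <-> exists2 u, u \in U & f u = x).

(* Main.v *)
(* Write e for the sum of the variables and G_k for the product over j < k of
   z_{2j} - z_{2j+1}.  The translates of G_k span the Specht module, and
   e is the sum of the z_{2j} - z_{2j+1} over all j < n/2 since n is even.
   The terms with j < k kill G_k in the quotient, and the others turn G_k into
   translates of G_{k+1}; so e maps T^k to T^{k+1}, with e T^{n/2} = 0 and
   e^2 = 0.  A partial derivative d preserves the ideal of the squares, maps
   T^{k+1} to T^k and kills T^0.  As d e = 1, we get x = e (d x) whenever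
   e x = 0, which gives exactness everywhere. *)
Require Import Defs.
From mathcomp Require Import all_boot all_order all_fingroup all_algebra.
From mathcomp Require Import generic_quotient ring_quotient boolp zify.

Set Implicit Arguments.
Unset Strict Implicit.
Unset Printing Implicit Defensive.

Import GRing.Theory.

Local Open Scope ring_scope.

(** * Specht modules of arbitrary shape *)

Section Specht.

Variables (n : nat) (lam : seq nat).

Lemma specht_submod : submod_closed (specht n lam).
Proof.
split.
  apply/asboolP; exists (fun _ _ => 0).
  by rewrite big1 // => t _; rewrite big1 // => s _; rewrite scale0r.
move=> c _ _ /asboolP[a ->] /asboolP[b ->]; apply/asboolP.
exists (fun t s => c * a t s + b t s).
rewrite scaler_sumr -big_split; apply: eq_bigr => t _ /=.
rewrite scaler_sumr -big_split; apply: eq_bigr => s _ /=.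
by rewrite scalerDl scalerA.
Qed.

Lemma msym_tableau_specht (t : {ffun cell lam -> 'I_n}) (s : 'S_n) :
  is_tableau t -> msym s (tableau_poly t) \in specht n lam.
Proof.
move=> tP; apply/asboolP.
exists (fun t' s' => ((t' == t) && (s' == s))%:R).
rewrite [RHS](bigD1 t tP) [X in _ = X + _](bigD1 s isT) /= !eqxx scale1r.
rewrite [X in _ + X + _]big1 => [|s' /negPf->]; last by rewrite scale0r.
rewrite [X in _ + X]big1 ?addr0 // => t' /andP[_ /negPf->].
by rewrite big1 // => s' _; rewrite scale0r.
Qed.

Lemma specht_ind (P : {mpoly 'F_2[n]} -> Prop) :
    P 0 -> (forall c p q, P p -> P q -> P (c *: p + q)) ->
    (forall t s, is_tableau t -> P (msym s (@tableau_poly n lam t))) ->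
  forall p, p \in specht n lam -> P p.
Proof.
move=> P0 PL Pt _ /asboolP[a ->].
have PD p q : P p -> P q -> P (p + q).
  by move=> Pp Pq; rewrite -[p]scale1r; apply: PL.
apply: (big_ind P) => // t tP; apply: (big_ind P) => // s _.
by rewrite -[_ *: _]addr0; apply: PL => //; apply: Pt.
Qed.

Lemma specht_msym (s : 'S_n) p :
  p \in specht n lam -> msym s p \in specht n lam.
Proof.
have [S0 SL] := specht_submod.
elim/specht_ind: p / => [|c p q pS qS|t s' tP].
- by rewrite msym0.
- by rewrite msymD msymZ; apply: (SL c _ _ pS qS).
- by rewrite -msymMm; apply: msym_tableau_specht.
Qed.

End Specht.

(** * Cells, tableaux and relabelling *)

Lemma cell_eq lam (c d : cell lam) :
  cell_row c = cell_row d -> cell_col c = cell_col d -> c = d.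
Proof.
case: c d => [i j] [i' j']; rewrite /cell_row /cell_col /= => /val_inj eq_i.
by case: _ / eq_i j' => j' /val_inj->.
Qed.

Lemma tableau_bij n lam (t : {ffun cell lam -> 'I_n}) :
  is_tableau t -> bijective t.
Proof.
case/andP=> /injectiveP t_inj /forallP t_surj.
apply: inj_card_bij => //; rewrite -(card_codom t_inj).
by apply/subset_leq_card/subsetP => i _; apply: t_surj.
Qed.

Lemma msymU n (s : 'S_n) i : msym s 'X_i = 'X_(s i) :> {mpoly 'F_2[n]}.
Proof.
rewrite msymX; congr 'X_[_]; apply/mnmP => j.
by rewrite mnmE !mnm1E -(inj_eq (@perm_inj _ s)) permKV.
Qed.

Lemma msym_tableau_poly n lam (t u : {ffun cell lam -> 'I_n}) (s : 'S_n) :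
  (forall c, u c = s (t c)) -> msym s (tableau_poly t) = tableau_poly u.
Proof.
move=> utE; rewrite rmorph_prod; apply: eq_bigr => cd _.
by rewrite /= msymB !msymU !utE.
Qed.

(** * Characteristic two and the ideal of squares *)

Lemma mpoly_opp2 n (p : {mpoly 'F_2[n]}) : - p = p.
Proof. by rewrite -scaleN1r (_ : -1 = 1) ?scale1r //; apply: val_inj. Qed.

Lemma mpoly_add2 n (p : {mpoly 'F_2[n]}) : p + p = 0.
Proof. by rewrite -{2}[p]mpoly_opp2 subrr. Qed.

Lemma zprojE0 n (p : {mpoly 'F_2[n]}) : zproj p = 0 <-> p \in zsq_ideal n.
Proof.
rewrite -[p in p \in _]subr0 (Quotient.idealrBE (zsq_ideal n : idealr _)).
by rewrite -(rmorph0 (@zproj n)); split=> /eqP.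
Qed.

(** The cross terms cancel in characteristic two. With [zproj_sqrU], every sum of variables thus
    squares to zero in the quotient. *)
Lemma zproj_sqrD n (p q : {mpoly 'F_2[n]}) :
  zproj (p * p) = 0 -> zproj (q * q) = 0 -> zproj ((p + q) * (p + q)) = 0.
Proof.
move=> p2 q2; have -> : (p + q) * (p + q) = p * p + q * q.
  by rewrite mulrDl !mulrDr [q * p]mulrC addrA -(addrA (_ * _)) mpoly_add2
    addr0.
by rewrite rmorphD /= p2 q2 addr0.
Qed.

Lemma zproj_sqrU n (i : 'I_n) : zproj ('X_i * 'X_i : {mpoly 'F_2[n]}) = 0.
Proof.
apply/zprojE0/asboolP; exists (fun j => (j == i)%:R).
rewrite (bigD1 i) //= eqxx mul1r expr2 big1 ?addr0 // => j /negPf->.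
by rewrite mul0r.
Qed.

(** * Partial derivatives *)

Lemma mderivU n (i j : 'I_n) :
  'X_j^`M(i) = (j == i)%:R :> {mpoly 'F_2[n]}.
Proof.
rewrite mderivX mnm1E; case: eqP => [->|_]; last by rewrite scale0r.
rewrite (_ : (U_(i) - U_(i))%MM = 0%MM) ?mpolyX0 ?scale1r //.
by apply/mnmP => j'; rewrite mnmBE mnm0E subnn.
Qed.

(** The derivative of a square vanishes in characteristic two, so the Leibniz rule only
    differentiates the coefficients [q j]. *)
Lemma mderiv_zsq_ideal n (i : 'I_n) p :
  p \in zsq_ideal n -> p^`M(i) \in zsq_ideal n.
Proof.
case/asboolP=> q ->; apply/asboolP; exists (fun j => (q j)^`M(i)).
rewrite raddf_sum; apply: eq_bigr => j _ /=.
by rewrite mderivM expr2 mderivM ['X_j * _^`M(i)]mulrC mpoly_add2 mulr0 addr0.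
Qed.

Lemma mderiv_prod n (i : 'I_n) k (f : nat -> {mpoly 'F_2[n]}) :
  (\prod_(j < k) f j)^`M(i) =
  \sum_(j < k) (f j)^`M(i) * \prod_(l < k | l != j :> nat) f l.
Proof.
elim: k => [|k IHk]; first by rewrite !big_ord0 -mpolyC1 mderivC.
rewrite !big_ord_recr /= mderivM IHk mulr_suml; congr (_ + _).
  apply: eq_bigr => j _; rewrite -mulrA; congr (_ * _).
  rewrite [RHS]big_mkcond big_ord_recr /= -big_mkcond.
  by rewrite gtn_eqF.
rewrite mulrC; congr (_ * _).
rewrite [RHS]big_mkcond big_ord_recr /= eqxx mulr1.
by apply: eq_bigr => j _; rewrite ltn_eqF.
Qed.

(** * Multiplication by the sum of the variables *)

Definition zsum n : {mpoly 'F_2[n]} := \sum_(i < n) 'X_i.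

Lemma msym_zsum n (s : 'S_n) : msym s (zsum n) = zsum n.
Proof.
rewrite raddf_sum /zsum [RHS](reindex_inj (@perm_inj _ s)).
by apply: eq_bigr => i _; apply: msymU.
Qed.

Lemma psi_zproj n (p : {mpoly 'F_2[n]}) : psi (zproj p) = zproj (zsum n * p).
Proof. by rewrite rmorphM rmorph_sum. Qed.

Lemma psi_psi n (x : zquot n) : psi (psi x) = 0.
Proof.
rewrite /psi mulrA -rmorph_sum -rmorphM /=.
suff -> : zproj (zsum n * zsum n) = 0 by rewrite mul0r.
apply: (big_ind (fun p => zproj (p * p) = 0)) => [|p q|i _].
- by rewrite mul0r rmorph0.
- exact: zproj_sqrD.
- exact: zproj_sqrU.
Qed.

(** The contracting homotopy: differentiating [zsum n * p] gives [p] plus [zsum n] times the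
    derivative of [p], and the result stays in the ideal of squares. *)
Lemma zproj_mderiv n (i : 'I_n) (p : {mpoly 'F_2[n]}) :
  zproj (zsum n * p) = 0 -> zproj p = zproj (zsum n * p^`M(i)).
Proof.
move/zprojE0/(mderiv_zsq_ideal i)/zprojE0; rewrite mderivM.
have ->: (zsum n)^`M(i) = 1.
  rewrite raddf_sum (bigD1 i) //= mderivU eqxx big1 ?addr0 // => j /negPf ji.
  by rewrite mderivU ji.
rewrite mul1r rmorphD /= => /eqP; rewrite addr_eq0 => /eqP->.
by rewrite -rmorphN mpoly_opp2.
Qed.

(** * The images of the Specht modules in the quotient *)

Section TModule.

Variables n k : nat.

Lemma T_zproj p : p \in specht n (two_row n k) -> zproj p \in T n k.
Proof. by move=> pS; apply/asboolP; exists p. Qed.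

Lemma T_submod : submod_closed (T n k).
Proof.
have [S0 SL] := @specht_submod n (two_row n k); split.
  by rewrite -(rmorph0 (@zproj n)); apply: T_zproj.
move=> c _ _ /asboolP[p pS ->] /asboolP[q qS ->].
by rewrite -zproj_scale -rmorphD; apply/T_zproj/(SL c _ _ pS qS).
Qed.

Lemma T_Sn_submodule : Sn_submodule (T n k).
Proof.
split=> [|s _ /asboolP[p pS ->]]; first exact: T_submod.
by rewrite zact_proj; apply/T_zproj/specht_msym.
Qed.

End TModule.

(** * Two-row shapes and their standard generator *)

Section TwoRow.

Variable m : nat.
Local Notation n := m.+1.

(** [inord] sends out-of-range numbers to 0, whence the bounds in [swap_pairs]. *)
Definition zpair (j : nat) : {mpoly 'F_2[n]} :=
  'X_(inord j.*2) - 'X_(inord j.*2.+1).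

Definition pair_poly (k : nat) : {mpoly 'F_2[n]} := \prod_(j < k) zpair j.

Section Tableau.

Variable k : nat.
Hypothesis k_le : (k.*2 <= n)%N.
Local Notation lam := (two_row n k).

(** Column [j < k] holds [j.*2] above [j.*2.+1]; a later column [c] holds [c + k], which uses up the
    labels from [k.*2] to [n - 1]. *)
Definition pair_tableau : {ffun cell lam -> 'I_n} :=
  [ffun c => inord (if cell_row c == 0%N then
    if (cell_col c < k)%N then (cell_col c).*2 else (cell_col c + k)%N
    else (cell_col c).*2.+1)].

Lemma two_row_bound (c : cell lam) :
  (cell_row c = 0%N /\ cell_col c < n - k)%N \/
  (cell_row c = 1%N /\ cell_col c < k)%N.
Proof.
by case: c => [[[|[|//]] i_lt] j]; rewrite /cell_row /cell_col /=;
  have := ltn_ord j; [left | right].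
Qed.

Lemma pair_tableau_is_tableau : is_tableau pair_tableau.
Proof.
have tE c : pair_tableau c = (if cell_row c == 0 then
    if cell_col c < k then (cell_col c).*2 else cell_col c + k
    else (cell_col c).*2.+1)%N :> nat.
  rewrite ffunE inordK //.
  by have [[-> cc]|[-> cc]] := two_row_bound c; rewrite /=; try case: ifP; lia.
have t_inj: injective pair_tableau.
  move=> c d /(congr1 (@nat_of_ord _)); rewrite !tE.
  have [[rc cc]|[rc cc]] := two_row_bound c;
  have [[rd cd]|[rd cd]] := two_row_bound d; rewrite rc rd /=;
  by do 2?[case: ifP => ?] => ?; by [lia | apply: (@cell_eq lam); lia].
have t_card: (#|'I_n| <= #|cell lam|)%N.
  rewrite card_ord card_tagged sumnE big_map big_enum /= !big_ord_recl big_ord0.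
  rewrite !card_ord /=; lia.
apply/andP; split; first exact/injectiveP.
apply/forallP => i; have [g _ gK] := inj_card_bij t_inj t_card.
by rewrite -[i]gK codom_f.
Qed.

Let cell0 (j : 'I_k) : cell lam :=
  @Tagged _ (@Ordinal 2 0 isT) (fun i : 'I_2 => 'I_(nth 0%N lam i))
    (@Ordinal (n - k) j ltac:(by have := ltn_ord j; lia)).
Let cell1 (j : 'I_k) : cell lam :=
  @Tagged _ (@Ordinal 2 1 isT) (fun i : 'I_2 => 'I_(nth 0%N lam i)) j.

Lemma tableau_poly_pair : tableau_poly pair_tableau = pair_poly k.
Proof.
(* A factor comes from a column [j < k] with two cells; [insub] recovers [j] from the lower one. *)
rewrite /tableau_poly (reindex_omap (fun j : 'I_k => (cell0 j, cell1 j))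
  (fun cd => insub (cell_col cd.2))) /=; last first.
  move=> [c d] /= /andP[/eqP eq_col lt_row].
  have [[rc cc]|[rc cc]] := two_row_bound c;
  have [[rd cd]|[rd cd]] := two_row_bound d; try lia.
  by rewrite insubT /=; congr (Some (_, _)); apply: (@cell_eq lam);
    rewrite ?rc ?rd.
apply: eq_big => [j|j _]; last first.
  by rewrite !ffunE /= /cell_col /= ltn_ord.
by rewrite /cell_col /cell_row /= eqxx valK eqxx.
Qed.

Lemma msym_pair_specht s : msym s (pair_poly k) \in specht n lam.
Proof.
by rewrite -tableau_poly_pair msym_tableau_specht // pair_tableau_is_tableau.
Qed.

(** Two tableaux of the same shape differ by a relabelling, so every [tableau_poly t] is a translate
    of [pair_poly k]. *)
Lemma specht_pair_ind (P : {mpoly 'F_2[n]} -> Prop) :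
    P 0 -> (forall c p q, P p -> P q -> P (c *: p + q)) ->
    (forall s, P (msym s (pair_poly k))) ->
  forall p, p \in specht n lam -> P p.
Proof.
move=> P0 PL PG; apply: specht_ind => // t s /tableau_bij[g tK gK].
have [h hK Kh] := tableau_bij pair_tableau_is_tableau.
have th_inj: injective (t \o h) by
  apply: inj_comp; [exact: can_inj tK | exact: can_inj Kh].
rewrite -(@msym_tableau_poly _ _ pair_tableau t (perm th_inj)) => [|c].
  by rewrite -msymMm tableau_poly_pair; apply: PG.
by rewrite permE /= hK.
Qed.

End Tableau.

(** * Permuting pairs, and the image of the generator *)

Lemma tperm_inord a b c : (a < n)%N -> (b < n)%N -> (c < n)%N ->
  tperm (inord a) (inord b) (inord c) =
  inord (if c == a then b else if c == b then a else c) :> 'I_n.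
Proof.
have inordE x y : (x < n)%N -> (y < n)%N ->
    (inord x == inord y :> 'I_n) = (x == y).
  by move=> x_lt y_lt; rewrite -val_eqE /= !inordK.
move=> a_lt b_lt c_lt; rewrite -inordE // -[c == b]inordE //.
by case: tpermP => [->|->|/eqP/negPf-> /eqP/negPf->] //;
  rewrite eqxx //; case: eqP.
Qed.

(** One transposition exchanges the even members of the two pairs, another the odd members. *)
Lemma swap_pairs j l : (j.*2.+1 < n)%N -> (l.*2.+1 < n)%N ->
  exists s : 'S_n, forall i, (i.*2.+1 < n)%N -> msym s (zpair i) =
    zpair (if i == j then l else if i == l then j else i).
Proof.
move=> j_lt l_lt; exists (tperm (inord j.*2) (inord l.*2) *
  tperm (inord j.*2.+1) (inord l.*2.+1))%g => i i_lt.
rewrite /zpair msymB !msymU !permM !tperm_inord; try by do ?case: ifP; lia.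
by congr ('X_(inord _) - 'X_(inord _)); do ?case: eqP; lia.
Qed.

Lemma zsum_pairs h : n = h.*2 -> zsum n = \sum_(j < h) zpair j.
Proof.
move=> nE.
(* The induction varies the number of pairs while the polynomial ring stays fixed, hence [inord]. *)
have <- : \sum_(i < h.*2) 'X_(inord i) = \sum_(j < h) zpair j.
  elim: h {nE} => [|h IHh]; first by rewrite !big_ord0.
  by rewrite doubleS !big_ord_recr /= IHh -addrA /zpair mpoly_opp2.
by rewrite -nE; apply: eq_bigr => i _; rewrite inord_val.
Qed.

Lemma zproj_pair_mul j k : (j < k)%N -> zproj (zpair j * pair_poly k) = 0.
Proof.
move=> jk; rewrite /pair_poly (bigD1 (Ordinal jk)) //= mulrA rmorphM /=.
suff ->: zproj (zpair j * zpair j) = 0 by rewrite mul0r.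
by rewrite /zpair mpoly_opp2 zproj_sqrD ?zproj_sqrU.
Qed.


Lemma zsum_pair_poly h k : n = h.*2 -> (k < h)%N ->
  zproj (zsum n * pair_poly k) \in T n k.+1.
Proof.
move=> nE kh; have [T0 TL] := T_submod n k.+1.
rewrite (zsum_pairs nE) mulr_suml rmorph_sum.
apply: (big_ind (fun x => x \in T n k.+1)) => // [x y xT yT|j _].
  by rewrite -[x]scale1r; apply: (TL 1 _ _ xT yT).
have [jk|kj] := ltnP j k; first by rewrite /= zproj_pair_mul.
have jh := ltn_ord j.
have [||s sE] := @swap_pairs k j; try lia.
(* Swapping pairs [k] and [j] fixes the pairs below [k] and turns the last factor of
   [pair_poly k.+1] into [zpair j]. *)
suff -> : zpair j * pair_poly k = msym s (pair_poly k.+1).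
  by apply/T_zproj/msym_pair_specht; lia.
rewrite rmorph_prod big_ord_recr /= sE ?eqxx; last lia.
rewrite mulrC; congr (_ * _); apply: eq_bigr => i _; have := ltn_ord i.
by move=> ik; rewrite sE ?(ltn_eqF ik) ?(ltn_eqF (leq_trans ik kj)) //; lia.
Qed.

Lemma psi_T h k x : n = h.*2 -> (k < h)%N -> x \in T n k -> psi x \in T n k.+1.
Proof.
move=> nE kh /asboolP[p pS ->]; rewrite psi_zproj; move: p pS.
have [T0 TL] := T_submod n k.+1; have [_ Tact] := T_Sn_submodule n k.+1.
apply: specht_pair_ind => [||c p q pT qT|s]; first lia.
- by rewrite mulr0 rmorph0.
- rewrite mulrDr -scalerAr rmorphD /= zproj_scale; exact: (TL c _ _ pT qT).
(* As [zsum n] is invariant, the permutation moves out of the product. *)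
rewrite -(msym_zsum s) -msymM -zact_proj; apply: Tact.
exact: zsum_pair_poly nE kh.
Qed.

Lemma psi_T_top h x : n = h.*2 -> x \in T n h -> psi x = 0.
Proof.
move=> nE /asboolP[p pS ->]; rewrite psi_zproj; move: p pS.
apply: specht_pair_ind => [||c p q pT qT|s]; first lia.
- by rewrite mulr0 rmorph0.
- by rewrite mulrDr -scalerAr rmorphD /= zproj_scale pT qT scaler0 addr0.
rewrite -(msym_zsum s) -msymM -zact_proj (zsum_pairs nE) mulr_suml.
(* Each of the [h] pairs is a factor of [pair_poly h], so every term vanishes. *)
rewrite rmorph_sum big1 => [|j _]; last exact: zproj_pair_mul.
by rewrite -(rmorph0 (@zproj n)) zact_proj msym0.
Qed.

(** * Derivatives of Specht elements, and exactness *)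

Lemma mderiv_specht k (i : 'I_n) p : (k.+1.*2 <= n)%N ->
  p \in specht n (two_row n k.+1) -> p^`M(i) \in specht n (two_row n k).
Proof.
move=> k_le; have [S0 SL] := specht_submod n (two_row n k).
move: p; apply: specht_pair_ind => // [|c q r qS rS|s].
- by rewrite mderiv0.
- by rewrite mderivD mderivZ; apply: (SL c _ _ qS rS).
(* By Leibniz, each term is a constant times a product of [k] of the [k.+1] pairs, hence a multiple
   of a translate of [pair_poly k]. *)
rewrite rmorph_prod /= (mderiv_prod i k.+1 (fun j => msym s (zpair j))).
apply: (big_ind (fun x => x \in specht n (two_row n k))) => // [x y xS yS|j _].
  by rewrite -[x]scale1r; apply: (SL 1 _ _ xS yS).
have [c ->] : exists c, (msym s (zpair j))^`M(i) = c%:MP.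
  rewrite msymB !msymU mderivB !mderivU -!mpolyC_nat -mpolyCB.
  by eexists.
rewrite mul_mpolyC -[_ *: _]addr0; apply: (SL c _ _ _ S0).
have jk := ltn_ord j.
have [||s' s'E] := @swap_pairs j k; try lia.
rewrite -(rmorph_prod (msym s)) /=.
suff -> : \prod_(l < k.+1 | l != j :> nat) zpair l = msym s' (pair_poly k).
  by apply/specht_msym/msym_pair_specht; lia.
(* Transposing [j] with the last index makes the omitted factor the last one, which splits off as
   1. *)
rewrite (reindex_inj (@perm_inj _ (tperm j ord_max))) /=.
rewrite big_mkcond big_ord_recr /= tpermR eqxx mulr1 rmorph_prod.
apply: eq_bigr => l _; have lk := ltn_ord l; rewrite /= s'E; last lia.
rewrite (ltn_eqF lk).
case: tpermP => [/(congr1 val)|/(congr1 val)|/eqP + _] /= => [lj|lk'|lj].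
- by rewrite lj eqxx gtn_eqF // -lj.
- by rewrite lk' ltnn in lk.
by rewrite (_ : (l == j :> nat) = false) //; apply/negbTE.
Qed.

Lemma psi_exact h k x : n = h.*2 -> (k < h)%N ->
  x \in T n k.+1 -> psi x = 0 -> exists2 u, u \in T n k & psi u = x.
Proof.
move=> nE kh /asboolP[p pS ->]; rewrite psi_zproj => /(zproj_mderiv ord0) pE.
exists (zproj p^`M(ord0)); last by rewrite psi_zproj.
by apply/T_zproj/mderiv_specht => //; lia.
Qed.

(** [pair_poly 0] is the empty product, so [T n 0] consists of constants, which the derivative
    kills. *)
Lemma psi_T0_eq0 x : x \in T n 0 -> psi x = 0 -> x = 0.
Proof.
move=> /asboolP[p pS ->]; rewrite psi_zproj => /(zproj_mderiv ord0)->.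
suff ->: p^`M(ord0) = 0 by rewrite mulr0 rmorph0.
move: p pS; apply: specht_pair_ind => // [|c p q pE qE|s].
- by rewrite mderiv0.
- by rewrite mderivD mderivZ pE qE scaler0 addr0.
by rewrite /pair_poly big_ord0 msym1 -mpolyC1 mderivC.
Qed.

End TwoRow.

(** * Equivariance and assembly of the exact sequence *)

Lemma psi_linear n (c : 'F_2) (x y : zquot n) :
  psi (c *: x + y) = c *: psi x + psi y.
Proof.
have -> : c *: x = zproj c%:MP * x by [].
have -> : c *: psi x = zproj c%:MP * psi x by [].
by rewrite /psi mulrDr mulrCA.
Qed.

Lemma psi_zact n (s : 'S_n) (x : zquot n) : psi (zact s x) = zact s (psi x).
Proof.
have [p ->] : exists p, x = zproj p by exists (repr x); rewrite /zproj reprK.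
by rewrite psi_zproj !zact_proj psi_zproj msymM msym_zsum.
Qed.

Theorem corollary5p12 (n : nat) (n_gt0 : (0 < n)%N) (n_even : ~~ odd n) :
  [/\ forall k : nat, (k <= n./2)%N -> Sn_submodule (T n k),
      forall k : nat, (1 <= k <= n./2)%N ->
        Sn_hom (T n k.-1) (T n k) (@psi n),
      {in T n 0 &, injective (@psi n)},
      forall k : nat, (1 <= k < n./2)%N ->
        exact_at (T n k.-1) (T n k) (@psi n) (@psi n)
    & {in T n n./2, forall y, exists2 x, x \in T n n./2.-1 & psi x = y}].
Proof.
case: n n_gt0 n_even => // m _ n_even.
have [h nE] : exists h, m.+1 = h.*2 by exists (m.+1)./2; rewrite even_halfK.
have -> : (m.+1)./2 = h by rewrite nE doubleK.
have h_gt0 : (0 < h)%N by lia.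
split=> [k _|[|k]//= kh|x y xT yT xy|[|k]//= kh|y yT].
- exact: T_Sn_submodule.
- split=> [x|c x y _ _|s x _]; first exact: psi_T nE kh.
    exact: psi_linear.
  exact: psi_zact.
- have [T0 TL] := T_submod m.+1 0; apply/eqP; rewrite -subr_eq0; apply/eqP.
  rewrite addrC -scaleN1r; apply: psi_T0_eq0; first exact: (TL _ _ _ yT xT).
  by rewrite psi_linear xy scaleN1r addNr.
- move=> x xT; split=> [|[u _ <-]]; last exact: psi_psi.
  by apply: psi_exact nE _ xT; lia.
(* Everything in the last module is killed by [psi], so surjectivity is the exactness argument once
   more. *)
- have yE := psi_T_top nE yT; case: h h_gt0 nE yT yE => // h _ nE yT yE.
  exact: psi_exact nE _ yT yE.
Qed.
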